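(* Let $d\ge 1$ be an integer, let $Y$ be the Cantor set, and let $Y\curvearrowleft\mathbb Z^d$ be a free action. Let $X$ be a compact Hausdorff space and let $X\curvearrowleft\mathbb Z^d$ be an extension of $Y\curvearrowleft\mathbb Z^d$. Then the dynamical asymptotic dimension of $X\curvearrowleft\mathbb Z^d$ is at most $3^d-1$.
   Context: Actions. Let $X$ be a topological space and $\Gamma$ a discrete group. A (right) $\Gamma$-action on $X$, denoted $X\curvearrowleft\Gamma$, is a continuous map $X\times\Gamma\to X$, $(x,\gamma)\mapsto x\gamma$, such that $xe=x$ and $(x\gamma_1)\gamma_2=x(\gamma_1\gamma_2)$ for all $x\in X$, $\gamma_1,\gamma_2\in\Gamma$. The action is free if $x\gamma=x$ for some $x\in X$ and $\gamma\in\Gamma$ implies $\gamma=e$. The action $X\curvearrowleft\Gamma$ is an extension of $Y\curvearrowleft\Gamma$ if there is a quotient map $\pi:X\to Y$ such that $\pi(x\gamma)=\pi(x)\gamma$ for all $x\in X$, $\gamma\in\Gamma$. Dynamical asymptotic dimension. Let $X\curvearrowleft\Gamma$ be an action of a discrete group on a compact Hausdorff space. Its dynamical asymptotic dimension is the smallest non-negative integer $m$ such that for any finite subset $\mathcal F\subseteq\Gamma$ there is an open cover $X=U_0\cup U_1\cup\cdots\cup U_m$ such that for each $0\le i\le m$ and each $x\in U_i$, the cardinality of the set $$\mathcal O_x:=\{y\in U_i:\ \exists\,\gamma_1,\dots,\gamma_K\in\mathcal F,\ y=x\gamma_1\cdots\gamma_K,\ x\gamma_1\cdots\gamma_k\in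 U_i,\ 1\le k\le K,\ K\in\mathbb N\}$$ is finite and uniformly bounded with respect to $x$ (i.e. there is $M$ with $|\mathcal O_x|\le M$ for all $i$ and all $x\in U_i$). The Cantor set is the usual one (compact, metrizable, totally disconnected, perfect, nonempty). *)

(* Defs.v *)
From mathcomp Require Import all_boot all_order all_algebra.
From mathcomp Require Import all_classical all_reals.
From mathcomp Require Import topology.

Set Implicit Arguments.
Unset Strict Implicit.
Unset Printing Implicit Defensive.

Import GRing.Theory.

Local Open Scope classical_set_scope.
Local Open Scope ring_scope.

(* The acting group is a discrete abelian group, written additively; Z^d is the
   zmodType 'rV[int]_d.  [act x g] is the right translate x g.  The alias
   [discrete_topology G] puts the discrete topology on G, whatever other
   topology the carrier may have. *)
Definition is_action (X : topologicalType) (G : zmodType) (act : X -> G -> X) :=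
  [/\ continuous (fun p : X * discrete_topology G => act p.1 p.2),
      forall x, act x 0 = x &
      forall x g h, act (act x g) h = act x (g + h)].

Definition free_action (X : topologicalType) (G : zmodType)
    (act : X -> G -> X) :=
  forall x g, act x g = x -> g = 0.

Definition quotient_map (X Y : topologicalType) (f : X -> Y) :=
  range f = [set: Y] /\ forall B : set Y, open B <-> open (f @^-1` B).

Definition is_extension (X Y : topologicalType) (G : zmodType)
    (actX : X -> G -> X) (actY : Y -> G -> Y) :=
  exists2 f : X -> Y, quotient_map f &
    forall x g, f (actX x g) = actY (f x) g.

(* Metrizability is carried by the type [Y : metricType R]. *)
Definition is_cantor_set (R : realType) (Y : metricType R) :=
  [/\ [set: Y] !=set0, compact [set: Y], totally_disconnected [set: Y] &
      perfect_set [set: Y]].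

(* [foldl act x (take k s)] is x s_1 ... s_k. *)
Definition partial_orbit (X : topologicalType) (G : zmodType)
    (act : X -> G -> X) (F : set G) (U : set X) (x : X) : set X :=
  [set y | U y /\ exists s : seq G,
    [/\ forall g, g \in s -> F g,
        y = foldl act x s &
        forall k, (1 <= k <= size s)%N -> U (foldl act x (take k s))]].

Definition dad_property (X : topologicalType) (G : zmodType)
    (act : X -> G -> X) (m : nat) :=
  forall F : set G, finite_set F ->
  exists U : 'I_m.+1 -> set X,
    [/\ forall i, open (U i),
        \bigcup_i U i = [set: X] &
        exists M : nat, forall i x, U i x ->
          (partial_orbit act F (U i) x #<= `I_M)%card].

(* The dynamical asymptotic dimension of [act] is finite and equal to m. *)
Definition is_dyn_asdim (X : topologicalType) (G : zmodType)
    (act : X -> G -> X) (m : nat) :=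
  dad_property act m /\ forall k, dad_property act k -> (m <= k)%N.

Definition dyn_asdim_le (X : topologicalType) (G : zmodType)
    (act : X -> G -> X) (n : nat) :=
  exists2 m, is_dyn_asdim act m & (m <= n)%N.

(* Main.v *)
Require Import Defs.
From mathcomp Require Import all_boot all_order all_algebra.
From mathcomp Require Import all_classical all_reals.
From mathcomp Require Import topology.
From mathcomp Require Import zify.

(** By zero-dimensionality and freeness, [Y] has a clopen set [C] whose visit
    times along every orbit are more than [N] apart in the sup norm, yet occur
    in every cube of radius [N]; its preimage in [X] is again such a set.  Let
    [S_M x] be the set of visit times of [x] of norm at most [M].  Put
    [K := 3 ^ d]; for [N <= M <= N + 2 r K] with [N = 4 r K], cutting the cube
    of radius [M] into [3 ^ d] subcubes gives [1 <= #|S_M x| <= K].  By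
    pigeonhole, along [M = N + 2 r t], [0 <= t <= K], the cardinality stalls at
    some value [k] between two consecutive radii, and [x] is put in the [k]-th
    open set.  If [F] lies in the cube of radius [r], a path with steps in [F]
    inside the [k]-th set carries the same [k] visited points with it, hence
    stays within bounded distance of each of them. *)

Import GRing.Theory.

Local Open Scope classical_set_scope.
Local Open Scope ring_scope.

(** * Compactness and zero-dimensionality *)

Lemma compact_seq_cover {T : topologicalType} (V : T -> set T) :
  compact [set: T] -> (forall x, nbhs x (V x)) ->
  exists s : seq T, forall y, exists2 x, x \in s & V x y.
Proof.
move=> cT nV.
(* Finite lists are directed by inclusion; compactness along this filter yields one list serving
   every point. *)
pose F := filter_from [set: seq T] (fun s => [set s' : seq T | {subset s <= s'}]).
have FF : Filter F.
  apply: filter_from_filter => [|s1 s2 _ _]; first by exists [::].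
  exists (s1 ++ s2) => // s sub; split=> x xs;
    by apply: sub; rewrite mem_cat xs ?orbT.
have [x _|s _ sP] := (compact_near_coveringP [set: T]).1 cT _ F
  (fun s y => exists2 x, x \in s & V x y) FF.
- exists (V x, [set s | x \in s]); last by move=> [y s] [Vy xs]; exists x.
  split; first exact: nV.
  by exists [:: x] => // s; apply; rewrite mem_head.
- by exists s => y; apply: (sP s).
Qed.

Lemma clopen_sub_quasi_component {T : topologicalType} (x : T) (W : set T) :
  compact [set: T] -> open W ->
  (forall y, (forall D, clopen D -> D x -> D y) -> W y) ->
  exists D, [/\ clopen D, D x & D `<=` W].
Proof.
move=> cT oW QW.
pose F := filter_from [set D : set T | clopen D /\ D x]
  (fun D => [set E | E `<=` D]).
have FF : Filter F.
  apply: filter_from_filter; first by exists setT; split => //; exact: clopenT.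
  move=> D E [cD Dx] [cE Ex]; exists (D `&` E).
    by split; [exact: clopenI | split].
  by move=> G GDE; split=> y /GDE[].
have cK : compact (~` W).
  by apply: (subclosed_compact _ cT) => //; exact: open_closedC.
have [y Wy|D [cD Dx] DP] := (compact_near_coveringP (~` W)).1 cK _ F
  (fun D y => ~ D y) FF.
- have [D [cD Dx Dy]] : exists D, [/\ clopen D, D x & ~ D y].
    apply: contrapT => nD; apply: Wy; apply: QW => D cD Dx.
    by apply: contrapT => Dy; apply: nD; exists D.
  exists (~` D, [set E | E `<=` D]).
    split; last by exists D.
    by apply: open_nbhs_nbhs; split => //; exact: closed_openC cD.2.
  by move=> [z E] [/= Dz ED] /ED.
- exists D; split=> // y Dy; apply: contrapT => Wy.
  exact: (DP D (@subset_refl _ D) y).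
Qed.

(** The quasi-component [Q] of [x] is connected, hence reduced to [x], so some clopen set separates
    [x] from [y]. *)
Lemma totally_disconnected_zero_dimensional {T : topologicalType} :
  hausdorff_space T -> compact [set: T] -> totally_disconnected [set: T] ->
  zero_dimensional T.
Proof.
move=> hT cT tdT x y xy.
pose Q := [set z | forall D : set T, clopen D -> D x -> D z].
have Qx : Q x by move=> D.
have clQ : closed Q.
  have -> : Q = \bigcap_(D in [set D : set T | clopen D /\ D x]) D.
    apply/seteqP; split=> z Qz D; first by move=> [cD Dx]; exact: Qz.
    by move=> cD Dx; exact: Qz.
  by apply: closed_bigI => D [[]].
(* Normality puts [A] in the interior of some [V] with closure off [B]. A clopen [D] around [x] that
   avoids the boundary of [V] has a clopen trace on [closure V], which must contain [Q]. *)
have QE A B : closed A -> closed B -> Q = A `|` B -> A `&` B = set0 -> A x ->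
    B = set0.
  move=> clA clB QAB AB0 Ax.
  have nB : set_nbhs A (~` B).
    move=> z Az; apply: open_nbhs_nbhs; split; first exact: closed_openC.
    by move=> Bz; have : (A `&` B) z by []; rewrite AB0.
  have [V AV VB] := compact_normal hT cT clA nB.
  have [||D [cD Dx DW]] := @clopen_sub_quasi_component T x
      (V° `|` ~` closure V) cT.
  - apply: openU; first exact: open_interior.
    by apply: closed_openC; exact: closed_closure.
  - move=> z Qz; have : Q z by [].
    by rewrite QAB => -[/AV Vz|Bz]; [left | right=> /VB].
  apply/seteqP; split=> // z Bz.
  have : Q z by rewrite QAB; right.
  move=> /(_ (D `&` closure V)) [||_ /VB //].
  - split; last by apply: closedI; [exact: cD.2 | exact: closed_closure].
    have -> : D `&` closure V = D `&` V°.
      apply/seteqP; split=> w [Dw Vw]; split=> //; first by case: (DW _ Dw).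
      by apply: subset_closure; apply: interior_subset.
    by apply: openI; [exact: cD.1 | exact: open_interior].
  - by split=> //; apply: subset_closure; apply: nbhs_singleton; exact: AV.
have conQ : connected Q.
  move=> B B0 [C oC BC] [E cE BE].
  have clB : closed B by rewrite BE; exact: closedI.
  have clB' : closed (Q `&` ~` C) by apply: closedI => //; exact: open_closedC.
  have QB : Q = B `|` (Q `&` ~` C).
    by rewrite BC -setIUr setUv setIT.
  have B_B' : B `&` (Q `&` ~` C) = set0.
    by rewrite BC setIACA setICr setI0.
  have [Bx|nBx] := pselect (B x).
    by rewrite QB (QE B (Q `&` ~` C) clB clB' QB B_B' Bx) setU0.
  have B'x : (Q `&` ~` C) x by split=> // Cx; apply: nBx; rewrite BC.
  have BE0 : B = set0 by apply: (QE (Q `&` ~` C)); rewrite 1?(setUC _ B) 1?(setIC _ B).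
  by move: B0; rewrite BE0 => -[].
apply: contrapT => nU.
have Qy : Q y.
  by move=> D cD Dx; apply: contrapT => Dy; apply: nU; exists D.
have : connected_component [set: T] x y.
  exact: (connected_component_max Qx (@subsetT _ Q) conQ).
by rewrite tdT//= => yx; move: xy; rewrite yx eqxx.
Qed.

(** * Cubes in Z^d and counting *)

Definition box (d M : nat) : seq 'rV[int]_d :=
  undup [seq \row_j ((f j : nat)%:Z - M%:Z) | f : {ffun 'I_d -> 'I_(M.*2.+1)}].

Lemma mem_box {d : nat} (M : nat) (g : 'rV[int]_d) :
  (g \in box d M) = [forall j, (`|g 0%R j| <= M)%N].
Proof.
rewrite mem_undup; apply/fintype.imageP/forallP => [[f _ ->] j|gM].
  by rewrite mxE; case: (f j) => a /= aM; lia.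
exists [ffun j => inord (absz (g 0%R j + M%:Z)%R)] => //.
by apply/rowP=> j; rewrite mxE ffunE inordK; have := gM j; move: (g 0%R j) => z; lia.
Qed.

Lemma box_le {d : nat} (M N : nat) (g : 'rV[int]_d) :
  (M <= N)%N -> g \in box d M -> g \in box d N.
Proof.
move=> MN; rewrite !mem_box => /forallP gM; apply/forallP => j.
exact: leq_trans (gM j) MN.
Qed.

Lemma boxN {d : nat} (M : nat) (g : 'rV[int]_d) :
  g \in box d M -> - g \in box d M.
Proof.
by rewrite !mem_box => /forallP gM; apply/forallP => j; rewrite mxE abszN.
Qed.

Lemma boxD {d : nat} (M N : nat) (g h : 'rV[int]_d) :
  g \in box d M -> h \in box d N -> g + h \in box d (M + N).
Proof.
rewrite !mem_box => /forallP gM /forallP hN; apply/forallP => j.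
have := gM j; have := hN j; rewrite mxE.
by move: (g 0%R j) (h 0%R j) => a b; lia.
Qed.

Lemma boxB {d : nat} (M N : nat) (g h : 'rV[int]_d) :
  g \in box d M -> h \in box d N -> g - h \in box d (M + N).
Proof. by move=> gM hN; apply: boxD => //; exact: boxN. Qed.

Lemma box0 (d M : nat) : 0 \in box d M.
Proof. by rewrite mem_box; apply/forallP => j; rewrite mxE. Qed.

Lemma finite_sub_box {d : nat} (F : set 'rV[int]_d) :
  finite_set F -> exists r, forall g, F g -> g \in box d r.
Proof.
move=> /finite_seqP[s ->] {F}.
elim: s => [|h s [r IH]]; first by exists 0%N.
exists (maxn r (\max_j `|h 0%R j|%N)) => g /=; rewrite in_cons => /orP[/eqP ->|].
  apply: (box_le _ _ _ (leq_maxr _ _)).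
  by rewrite mem_box; apply/forallP => j; exact: leq_bigmax.
by move=> /IH; apply: box_le; exact: leq_maxl.
Qed.

(* Cut the box into [k.+1 ^ d] cubes of side [n.+1]: each contains at most one
   point of [s]. *)
Lemma size_separated {d : nat} (M n k : nat) (s : seq 'rV[int]_d) :
  (M.*2 < k.+1 * n.+1)%N -> uniq s -> {subset s <= box d M} ->
  {in s &, forall g h, g - h \in box d n -> g = h} ->
  (size s <= k.+1 ^ d)%N.
Proof.
move=> Mkn us sM sep.
pose cube (g : 'rV[int]_d) : {ffun 'I_d -> 'I_k.+1} :=
  [ffun j => inord (absz (g 0%R j + M%:Z)%R %/ n.+1)].
(* Shifted coordinates lie between 0 and [M.*2], so the bound on [M] keeps the quotient in the range
   of [inord]. *)
have cubeE g j : g \in s -> cube g j = (absz (g 0%R j + M%:Z)%R %/ n.+1)%N :> nat.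
  move=> /sM; rewrite mem_box => /forallP/(_ j) gM.
  rewrite ffunE inordK// ltn_divLR//.
  by move: (g 0%R j) gM => a; lia.
have cube_inj : {in s &, injective cube}.
  move=> g h gs hs gh; apply: sep => //; rewrite mem_box; apply/forallP => j.
  have := cubeE g j gs; have := cubeE h j hs; rewrite gh => -> E.
  have := sM _ gs; have := sM _ hs; rewrite !mem_box.
  move=> /forallP/(_ j) hM /forallP/(_ j) gM; rewrite !mxE.
  have := divn_eq (absz (g 0%R j + M%:Z)%R) n.+1; have := divn_eq (absz (h 0%R j + M%:Z)%R) n.+1.
  have := ltn_pmod (absz (g 0%R j + M%:Z)%R) (ltn0Sn n).
  have := ltn_pmod (absz (h 0%R j + M%:Z)%R) (ltn0Sn n).
  rewrite E; move: (g 0%R j) (h 0%R j) hM gM {E} => a b.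
  move: (_ %/ _)%N => q; lia.
rewrite -(size_map cube) -(card_uniqP _) ?map_inj_in_uniq//.
by rewrite (leq_trans (max_card _))// card_ffun !card_ord.
Qed.

(** Without a stall, [K] strict increases from a positive value would exceed [K]. *)
Lemma nondecreasing_stalls (K : nat) (a : nat -> nat) :
  (forall t, (a t <= a t.+1)%N) -> (0 < a 0)%N -> (a K <= K)%N ->
  exists2 t, (t < K)%N & a t = a t.+1.
Proof.
move=> amono a0 aK; apply: contrapT => na.
have grow t : (t <= K)%N -> (t < a t)%N.
  elim: t => // t IH tK; have := IH (ltnW tK); have := amono t.
  rewrite leq_eqVlt => /orP[/eqP E|]; last lia.
  by case: na; exists t.
by have := grow K (leqnn K); rewrite ltnNge aK.
Qed.

(** * Clopen markers for free actions *)

Lemma act_continuous {X : topologicalType} {G : zmodType} (act : X -> G -> X)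
    (g : G) :
  is_action act -> continuous (fun x => act x g).
Proof.
move=> [cact _ _] x.
pose g' : discrete_topology G := g.
apply: (@continuous2_cvg X X (discrete_topology G) X (nbhs x) _ id (fun=> g')
  (fun x g => act x g) x g'); [exact: (cact (x, g')) | exact: cvg_id | exact: cvg_cst].
Qed.

Lemma clopen_translates {X : topologicalType} {G : zmodType}
    (act : X -> G -> X) (S : seq G) (C : set X) :
  is_action act -> clopen C ->
  clopen [set x | exists2 g, g \in S & C (act x g)].
Proof.
move=> hact cC; elim: S => [|g S IH].
  have -> : [set x | exists2 g, g \in [::] & C (act x g)] = set0.
    by apply/seteqP; split=> // x [].
  exact: clopen0.
have -> : [set x | exists2 h, h \in g :: S & C (act x h)] =
  ((fun x => act x g) @^-1` C) `|` [set x | exists2 g, g \in S & C (act x g)].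
  apply/seteqP; split=> x.
    by move=> [h]; rewrite in_cons => /orP[/eqP ->|hS Ch]; [left|right; exists h].
  move=> [Cg|[h hS Ch]]; first by exists g => //; rewrite mem_head.
  by exists h => //; rewrite in_cons hS orbT.
by apply: clopenU => //; apply: preimage_clopen => //; exact: act_continuous.
Qed.

(** A nonzero [g] moves [x], so some clopen [U] contains [x] but not its translate; keep only the
    points of [U] that [g] sends outside [U], for each [g] in turn. *)
Lemma free_action_displaces {X : topologicalType} {G : zmodType}
    (act : X -> G -> X) (S : seq G) (x : X) :
  is_action act -> free_action act -> zero_dimensional X ->
  exists V, [/\ clopen V, V x &
    forall y g, g \in S -> V y -> V (act y g) -> g = 0].
Proof.
move=> hact fact zX; elim: S => [|g S [V [cV Vx VS]]].
  by exists setT; split => //; exact: clopenT.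
have [g0|g0] := eqVneq g 0.
  exists V; split => // y h; rewrite in_cons => /orP[/eqP -> //|].
  exact: VS.
have xg : x != act x g by apply: contraNneq g0 => /esym/fact ->.
have [U [cU Ux Uxg]] := zX _ _ xg.
exists (V `&` (U `&` (fun y => act y g) @^-1` (~` U))); split.
- apply: clopenI => //; apply: clopenI => //.
  by apply: preimage_clopen; [exact: clopenC | exact: act_continuous].
- by [].
- move=> y h; rewrite in_cons => /orP[/eqP ->|hS].
    by move=> [_ [_ /= nU]] [_ [/nU]].
  by move=> [Vy _] [Vyh _]; exact: (VS y).
Qed.

(** Greedy construction: run through a finite cover by displaced clopen sets, adding the points of
    each that [S] does not carry into the current [C]. Symmetry of [S] separates old points from new
    ones, and [0 \in S] makes new points reach [C]. *)
Lemma clopen_marker {X : topologicalType} {G : zmodType}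
    (act : X -> G -> X) (S : seq G) :
  compact [set: X] -> zero_dimensional X -> is_action act ->
  free_action act -> 0 \in S -> {in S, forall g, - g \in S} ->
  exists C, [/\ clopen C,
    forall x g, g \in S -> C x -> C (act x g) -> g = 0 &
    forall x, exists2 g, g \in S & C (act x g)].
Proof.
move=> cX zX hact fact S0 SN; have [_ act0 actD] := hact.
pose V x := projT1 (cid (free_action_displaces act S x hact fact zX)).
have VP x : [/\ clopen (V x), V x x &
    forall y g, g \in S -> V x y -> V x (act y g) -> g = 0].
  exact: projT2 (cid (free_action_displaces act S x hact fact zX)).
have [x|s sP] := compact_seq_cover V cX.
  by have [cV Vx _] := VP x; apply: open_nbhs_nbhs; split=> //; exact: cV.1.
suff [C [cC Csep Ccov]] : exists C, [/\ clopen C,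
    forall x g, g \in S -> C x -> C (act x g) -> g = 0 &
    forall x y, x \in s -> V x y -> exists2 g, g \in S & C (act y g)].
  exists C; split => // y; have [x xs Vxy] := sP y; exact: Ccov Vxy.
elim: s {sP} => [|x s [C [cC Csep Ccov]]].
  by exists set0; split => //; exact: clopen0.
pose D := [set y | exists2 g, g \in S & C (act y g)].
have [cV _ Vsep] := VP x.
exists (C `|` (V x `&` ~` D)); split.
- apply: clopenU => //; apply: clopenI => //; apply: clopenC => //.
  exact: clopen_translates.
- move=> y g gS [Cy|[Vy Dy]] [Cyg|[Vyg Dyg]]; first exact: (Csep y).
  + by case: Dyg; exists (- g); [exact: SN | rewrite actD subrr act0].
  + by case: Dy; exists g.
  + exact: (Vsep y).
- move=> z y; rewrite in_cons => /orP[/eqP ->|zs] Vy.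
    have [[g gS Cg]|nD] := pselect (D y); first by exists g => //; left.
    by exists 0 => //; right; rewrite act0.
  by have [g gS Cg] := Ccov z y zs Vy; exists g => //; left.
Qed.

(** * Visit times and the level sets *)

Definition markers {d : nat} {X : Type} (act : X -> 'rV[int]_d -> X)
    (C : set X) (M : nat) (x : X) : seq 'rV[int]_d :=
  [seq g <- box d M | `[< C (act x g) >]].

(** The window of width [2 * r] leaves room for a step of norm at most [r] and its inverse. The
    stalling index [t] may vary from point to point. *)
Definition level {d : nat} {X : Type} (act : X -> 'rV[int]_d -> X)
    (C : set X) (N r K k : nat) : set X :=
  [set x | exists2 t, (t < K)%N &
    size (markers act C (N + 2 * r * t) x) = k /\
    size (markers act C (N + 2 * r * t + 2 * r) x) = k].

Lemma mem_markers {d : nat} {X : Type} (act : X -> 'rV[int]_d -> X)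
    (C : set X) (M : nat) (x : X) (g : 'rV[int]_d) :
  (g \in markers act C M x) = `[< C (act x g) >] && (g \in box d M).
Proof. exact: mem_filter. Qed.

Lemma markers_uniq {d : nat} {X : Type} (act : X -> 'rV[int]_d -> X)
    (C : set X) (M : nat) (x : X) :
  uniq (markers act C M x).
Proof. by rewrite filter_uniq// undup_uniq. Qed.

Lemma markers_le {d : nat} {X : Type} (act : X -> 'rV[int]_d -> X)
    (C : set X) (M N : nat) (x : X) :
  (M <= N)%N -> {subset markers act C M x <= markers act C N x}.
Proof.
by move=> MN g; rewrite !mem_markers => /andP[-> /(box_le _ _ _ MN) ->].
Qed.

Lemma size_markers_le {d : nat} {X : Type} (act : X -> 'rV[int]_d -> X)
    (C : set X) (M N : nat) (x : X) :
  (M <= N)%N -> (size (markers act C M x) <= size (markers act C N x))%N.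
Proof.
by move=> MN; apply: uniq_leq_size; [exact: markers_uniq | exact: markers_le].
Qed.

(** Each of the finitely many membership tests is locally constant since [C] is clopen; openness of
    the levels follows. *)
Lemma near_markers {d : nat} {X : topologicalType}
    (act : X -> 'rV[int]_d -> X) (C : set X) (M : nat) (x : X) :
  is_action act -> clopen C ->
  \forall y \near x, markers act C M y = markers act C M x.
Proof.
move=> hact [oC cC]; rewrite /markers; elim: (box d M) => [|g s IH].
  exact: nearW.
have gC : \forall y \near x, `[< C (act y g) >] = `[< C (act x g) >].
  have cg := act_continuous act g hact.
  case: (asboolP (C (act x g))) => Cxg.
    have : nbhs x ((fun y => act y g) @^-1` C).
      by apply: cg; exact: open_nbhs_nbhs.
    by apply: filterS => y Cy; apply/asboolP.
  have : nbhs x ((fun y => act y g) @^-1` (~` C)).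
    by apply: cg; apply: open_nbhs_nbhs; split => //; exact: closed_openC.
  by apply: filterS => y Cy; apply/asboolP.
by apply: filterS2 gC IH => y /= -> ->.
Qed.

Lemma open_level {d : nat} {X : topologicalType}
    (act : X -> 'rV[int]_d -> X) (C : set X) (N r K k : nat) :
  is_action act -> clopen C -> open (level act C N r K k).
Proof.
move=> hact cC; rewrite openE => x [t tK [s1 s2]].
have := near_markers act C (N + 2 * r * t) x hact cC.
have := near_markers act C (N + 2 * r * t + 2 * r) x hact cC.
by apply: filterS2 => y E1 E2; exists t => //; rewrite E1 E2.
Qed.

Lemma level_cover {d : nat} {X : Type} (act : X -> 'rV[int]_d -> X)
    (C : set X) (N r K : nat) (x : X) :
  (0 < size (markers act C N x))%N ->
  (size (markers act C (N + 2 * r * K) x) <= K)%N ->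
  exists k : 'I_K, level act C N r K k.+1 x.
Proof.
move=> pos bound.
pose a t := size (markers act C (N + 2 * r * t) x).
have amono t : (a t <= a t.+1)%N by apply: size_markers_le; lia.
have a_gt0 t : (0 < a t)%N.
  by apply: leq_trans pos _; apply: size_markers_le; lia.
have [t tK at1] := nondecreasing_stalls K a amono (a_gt0 0%N) bound.
(* The common count lies between 1 and [K], hence the shift by one in the index. *)
have atK : ((a t).-1 < K)%N.
  rewrite prednK//; apply: leq_trans bound; apply: size_markers_le.
  by rewrite leq_add2l leq_mul2l (ltnW tK) orbT.
exists (Ordinal atK); exists t => //=; rewrite prednK//; split=> //.
rewrite -/(a t) at1 /a; congr (size (markers _ _ _ _)); lia.
Qed.

(* Translating by at most [r] sandwiches the markers of [act x g] at radius
   [M + r] between those of [x] at radii [M] and [M + 2 * r], which coincide;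
   nestedness then lets [N] replace [M + r]. *)
Lemma markers_translate {d : nat} {X : topologicalType}
    (act : X -> 'rV[int]_d -> X) (C : set X) (M N r : nat) (x : X)
    (g c : 'rV[int]_d) :
  is_action act -> g \in box d r ->
  size (markers act C (M + 2 * r) x) = size (markers act C M x) ->
  size (markers act C N (act x g)) = size (markers act C M x) ->
  c \in markers act C M x -> c - g \in markers act C N (act x g).
Proof.
move=> [_ _ actD] gr sM sN.
have sub : {subset [seq c - g | c <- markers act C M x] <=
    markers act C (M + r) (act x g)}.
  move=> _ /mapP[h + ->]; rewrite !mem_markers actD addrC subrK.
  by move=> /andP[-> hM]; exact: boxB.
have sup : {subset [seq c + g | c <- markers act C (M + r) (act x g)] <=
    markers act C (M + 2 * r) x}.
  move=> _ /mapP[h + ->]; rewrite !mem_markers actD (addrC g).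
  by move=> /andP[-> hM]; rewrite mul2n -addnn addnA; exact: boxD.
have := uniq_leq_size _ sub; have := uniq_leq_size _ sup.
rewrite !map_inj_uniq; [|exact: addIr..]; rewrite !markers_uniq !size_map.
move=> /(_ isT) le1 /(_ isT) le2 cM.
have {sub}cMr : c - g \in markers act C (M + r) (act x g).
  by apply: sub; exact: map_f.
have [NM|/ltnW MN] := leqP N (M + r); last exact: markers_le MN _ cMr.
have [|_ ->//] := uniq_min_size (markers_uniq act C N (act x g))
  (markers_le act C _ _ (act x g) NM).
by rewrite sN -sM.
Qed.

(** * Paths inside a level set *)

Lemma foldl_act {X : topologicalType} {G : zmodType} (act : X -> G -> X)
    (x : X) (s : seq G) :
  is_action act -> foldl act x s = act x (\sum_(g <- s) g).
Proof.
move=> [_ act0 actD]; elim: s x => [|g s IH] x /=; first by rewrite big_nil act0.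
by rewrite IH big_cons actD.
Qed.

(** Induction along the path: [c], recentred at the current point, remains a marker at the stalling
    radius of that point. This radius may change at each step but never exceeds [N + 2 * r * K]. *)
Lemma level_path {d : nat} {X : topologicalType}
    (act : X -> 'rV[int]_d -> X) (C : set X) (N r K k t : nat)
    (s : seq 'rV[int]_d) (x : X) (c : 'rV[int]_d) :
  is_action act -> {in s, forall g, g \in box d r} -> (t < K)%N ->
  size (markers act C (N + 2 * r * t) x) = k ->
  size (markers act C (N + 2 * r * t + 2 * r) x) = k ->
  (forall j, (1 <= j <= size s)%N ->
    level act C N r K k (foldl act x (take j s))) ->
  c \in markers act C (N + 2 * r * t) x ->
  c - \sum_(g <- s) g \in box d (N + 2 * r * K).
Proof.
move=> hact; elim: s x t c => [|g s IH] x t c sr tK s1 s2 path cx.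
  rewrite big_nil subr0; move: cx; rewrite mem_markers => /andP[_].
  by apply: box_le; rewrite leq_add2l leq_mul2l (ltnW tK) orbT.
have [|t' t'K [s1' s2']] := path 1%N; first by [].
rewrite /= take0 /= in s1' s2'.
rewrite big_cons opprD addrA; apply: (IH (act x g) t') => //.
- by move=> h hs; apply: sr; rewrite in_cons hs orbT.
- by move=> j /andP[j0 js]; exact: (path j.+1).
- apply: (markers_translate act C (N + 2 * r * t) _ r) => //.
  + by apply: sr; rewrite mem_head.
  + by rewrite s2 s1.
  + by rewrite s1' s1.
Qed.

Lemma card_seq_le {T : eqType} (U : Type) (f : T -> U) (s : seq T) (x0 : T) :
  (f @` [set` s] #<= `I_(size s))%card.
Proof.
apply: card_le_trans (card_image_le (fun i => f (nth x0 s i)) `I_(size s)).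
apply: subset_card_le => _ [x /= xs <-].
by exists (index x s); rewrite /= ?index_mem// nth_index.
Qed.

(** As [k.+1] is positive, there is a marker [c]. Both [c] and [c] minus the total displacement lie
    in the cube of radius [N + 2 * r * K], so their difference lies in the cube of twice that
    radius. *)
Lemma level_orbit {d : nat} {X : topologicalType}
    (act : X -> 'rV[int]_d -> X) (C : set X) (N r K k : nat)
    (F : set 'rV[int]_d) (x : X) :
  is_action act -> (forall g, F g -> g \in box d r) ->
  level act C N r K k.+1 x ->
  partial_orbit act F (level act C N r K k.+1) x `<=`
    act x @` [set` box d ((N + 2 * r * K) + (N + 2 * r * K))].
Proof.
move=> hact Fr [t tK [s1 s2]] y [_ [s [sF -> path]]].
rewrite foldl_act//; exists (\sum_(g <- s) g) => //=.
have [c cx] : exists c, c \in markers act C (N + 2 * r * t) x.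
  by case: (markers _ _ _ _) s1 => // c l _; exists c; rewrite mem_head.
have sr : {in s, forall g, g \in box d r} by move=> g /sF /Fr.
have cs := level_path _ _ _ _ _ _ _ _ _ _ hact sr tK s1 s2 path cx.
have cK : c \in box d (N + 2 * r * K).
  move: cx; rewrite mem_markers => /andP[_].
  by apply: box_le; rewrite leq_add2l leq_mul2l (ltnW tK) orbT.
by rewrite -[X in X \in _](subKr c); exact: boxB.
Qed.

(** * The dimension bound *)

(** Markers are built in [Y] and pulled back; by equivariance [x] and [f x] have the same visit
    times. *)
Lemma dad_property_free_extension {d : nat} {X Y : topologicalType}
    (actX : X -> 'rV[int]_d -> X) (actY : Y -> 'rV[int]_d -> Y) (f : X -> Y) :
  compact [set: Y] -> zero_dimensional Y -> is_action actY ->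
  free_action actY -> is_action actX -> continuous f ->
  (forall x g, f (actX x g) = actY (f x) g) ->
  dad_property actX (3 ^ d - 1)%N.
Proof.
move=> cY zY hY fY hX cf fact F /finite_sub_box[r Fr].
have E3 : (3 ^ d - 1).+1 = (3 ^ d)%N by rewrite subn1 prednK// expn_gt0.
rewrite E3.
(* This [N] makes the largest radius satisfy [2 * (N + 2 * r * K) = 3 * N < 3 * N.+1], so three
   intervals of length [N.+1] per coordinate suffice. *)
set K := (3 ^ d)%N; pose N := (4 * r * K)%N.
have [C [cC Csep Ccov]] := clopen_marker actY (box d N) cY zY hY fY (box0 d N)
  (fun g => @boxN d N g).
pose D := f @^-1` C.
have cD : clopen D by exact: preimage_clopen.
exists (fun i : 'I_K => level actX D N r K i.+1); split.
- by move=> i; exact: open_level.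
- apply/seteqP; split=> // x _.
  have [||k xk] := @level_cover d X actX D N r K x; last by exists k.
  + have [g gN Cg] := Ccov (f x).
    suff : g \in markers actX D N x by case: (markers _ _ _ _).
    by rewrite mem_markers gN andbT; apply/asboolP; rewrite /D /= fact.
  + apply: (@size_separated d (N + 2 * r * K) N); first by rewrite /N; lia.
    * exact: markers_uniq.
    * by move=> g; rewrite mem_markers => /andP[].
    * move=> g h; rewrite !mem_markers /D /= !fact.
      move=> /andP[/asboolP Cg _] /andP[/asboolP Ch _] ghN.
      apply/eqP; rewrite -subr_eq0; apply/eqP.
      (* Separation is applied at the visit with time [h], from which [g - h] leads to the visit
         with time [g]. *)
      apply: (Csep (actY (f x) h)) => //.
      by have [_ _ ->] := hY; rewrite addrC subrK.
- pose L := (N + 2 * r * K)%N.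
  exists (size (box d (L + L))) => i x xi.
  apply: card_le_trans (card_seq_le _ (actX x) (box d (L + L)) 0).
  by apply: subset_card_le; exact: level_orbit.
Qed.

Theorem mainTheorem1 (R : realType) (d : nat) (hd : (1 <= d)%N)
    (Y : metricType R) (hY : is_cantor_set Y)
    (actY : Y -> 'rV[int]_d -> Y) (hactY : is_action actY)
    (hfree : free_action actY)
    (X : topologicalType) (cX : compact [set: X]) (hX : hausdorff_space X)
    (actX : X -> 'rV[int]_d -> X) (hactX : is_action actX)
    (hext : is_extension actX actY) :
  dyn_asdim_le actX (3 ^ d - 1)%N.
Proof.
have [_ cY tdY _] := hY; have [f [_ qf] fact] := hext.
have dadX : dad_property actX (3 ^ d - 1)%N.
  apply: (dad_property_free_extension _ _ _ cY _ hactY hfree hactX _ fact).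
    exact: (totally_disconnected_zero_dimensional (@metric_hausdorff R Y) cY tdY).
  by apply/continuousP => B /qf.
(* The dimension is an exact minimum, obtained by well-ordering once some value qualifies. *)
have exm : exists m, `[< dad_property actX m >].
  by exists (3 ^ d - 1)%N; apply/asboolP.
have [m /asboolP dadm min_m] := ex_minnP exm.
exists m; last by apply: min_m; apply/asboolP.
by split=> // k dadk; apply: min_m; apply/asboolP.
Qed.
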